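(* Let $\mathcal{H}$ be a complex Hilbert space and let $A,B,C,D\in\mathcal{B}(\mathcal{H})$. Then $$\omega(AB+CD)\le \omega\left(\begin{bmatrix} O & AB\\ CD & O\end{bmatrix}\right)+\frac12\sqrt{\left\|(AB)^2\right\|+\left\|(D^*C^* )^2\right\|+\left\|ABD^*C^*+D^*C^*AB\right\|}.$$ In particular, for all $A,C\in\mathcal{B}(\mathcal{H})$ and for either choice of the sign $\pm$, $$\omega(A\pm C)\le \omega\left(\begin{bmatrix} O & A\\ C & O\end{bmatrix}\right)+\frac12\sqrt{\left\|A^2\right\|+\left\|C^2\right\|+\left\|AC^*+C^*A\right\|}.$$
   Context: $\mathcal{B}(\mathcal{H})$ is the $C^*$-algebra of all bounded linear operators on $\mathcal{H}$. For a bounded operator $X$ on a complex Hilbert space, $\|X\|=\sup_{\|x\|=1}\|Xx\|$ is the operator norm and $\omega(X)=\sup_{\|x\|=1}|\langle Xx,x\rangle|$ is the numerical radius. $O$ is the zero operator, and $2\times 2$ block matrices with entries in $\mathcal{B}(\mathcal{H})$ denote operators on $\mathcal{H}\oplus\mathcal{H}$. *)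

(* Defs.v *)
From HB Require Import structures.
From mathcomp Require Import all_boot all_order all_algebra.
From mathcomp Require Import sesquilinear complex ring lra.
From mathcomp Require Import all_classical all_reals topology normedtype.

Set Implicit Arguments.
Unset Strict Implicit.
Unset Printing Implicit Defensive.

Import Order.TTheory GRing.Theory Num.Theory.
Import numFieldNormedType.Exports.

Local Open Scope classical_set_scope.
Local Open Scope ring_scope.

(* The inner product is linear in its first argument. *)
HB.mixin Record CompleteNormedModule_isHilbert (C : numClosedFieldType) H
    & CompleteNormedModule C H := {
  inner : {dot H for (@Num.conj C)} ;
  inner_norm : forall x : H, inner x x = `|x| ^+ 2
}.

#[short(type="hilbertType")]
HB.structure Definition Hilbert (C : numClosedFieldType) :=
  {H of CompleteNormedModule C H & CompleteNormedModule_isHilbert C H}.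

(* An alias of H * K: the library equips H * K itself with the sup norm, which
   is not the norm of the orthogonal direct sum. *)
Definition hsum (H K : Type) : Type := (H * K)%type.

Section HilbertSum.
Context {C : numClosedFieldType} (H K : hilbertType C).

HB.instance Definition _ := GRing.Lmodule.copy (hsum H K) (H * K)%type.

Let norm (u : hsum H K) : C := sqrtC (`|u.1| ^+ 2 + `|u.2| ^+ 2).

Let normE u : norm u = `| `|u.1| + 'i * `|u.2| |.
Proof.
apply/eqP; rewrite -(@eqrXn2 _ 2)// ?sqrtC_ge0 ?addr_ge0 ?exprn_ge0//.
by rewrite sqrtCK normC2_rect ?ger0_real.
Qed.

Let ler_normD u v : norm (u + v) <= norm u + norm v.
Proof.
apply: (@le_trans _ _ `| (`|u.1| + `|v.1|) + 'i * (`|u.2| + `|v.2|) |).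
  rewrite normE -(@ler_pXn2r _ 2) ?nnegrE// !normC2_rect
    ?ger0_real ?addr_ge0//.
  by rewrite lerD// ler_pXn2r ?nnegrE ?addr_ge0// ler_normD.
by rewrite !normE mulrDr addrACA; exact: ler_normD.
Qed.

Let normrZ (l : C) u : norm (l *: u) = `|l| * norm u.
Proof.
by rewrite /norm/= !normrZ !exprMn -mulrDr sqrtCM ?nnegrE ?addr_ge0 ?exprn_ge0//
  sqrCK.
Qed.

Let normr0_eq0 u : norm u = 0 -> u = 0.
Proof.
move=> /eqP; rewrite sqrtC_eq0 paddr_eq0 ?exprn_ge0//.
by case: u => a b /=; rewrite !sqrf_eq0 !normr_eq0 => /andP[/eqP-> /eqP->].
Qed.

HB.instance Definition _ :=
  @Lmodule_isNormed.Build C (hsum H K) norm ler_normD normrZ normr0_eq0.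

Lemma hsum_normE (u : hsum H K) : `|u| = sqrtC (`|u.1| ^+ 2 + `|u.2| ^+ 2).
Proof. by []. Qed.

Lemma ler_hsum_norm1 (u : hsum H K) : `|u.1| <= `|u|.
Proof.
by rewrite hsum_normE -[leLHS]sqrCK// ler_sqrtC ?nnegrE ?addr_ge0 ?exprn_ge0//
  lerDl exprn_ge0.
Qed.

Lemma ler_hsum_norm2 (u : hsum H K) : `|u.2| <= `|u|.
Proof.
by rewrite hsum_normE -[leLHS]sqrCK// ler_sqrtC ?nnegrE ?addr_ge0 ?exprn_ge0//
  lerDr exprn_ge0.
Qed.

Lemma ler_hsum_norm (u : hsum H K) : `|u| <= `|u.1| + `|u.2|.
Proof.
rewrite -[leLHS]/(norm u) normE (le_trans (Num.Theory.ler_normD _ _))//.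
by rewrite normrM normCi mul1r !normr_id.
Qed.

Let complete_hsum (F : set_system (hsum H K)) :
  ProperFilter F -> cauchy F -> cvg F.
Proof.
move=> FF /cauchyP Fc.
have c1 : cvg (fst @ F : set_system H).
  apply/cauchy_cvgP/cauchyP => e /Fc[u Fu]; exists u.1.
  suff: F (fst @^-1` ball u.1 e) by [].
  apply: filterS Fu => v /=; rewrite -!ball_normE /ball_/=.
  exact/le_lt_trans/(ler_hsum_norm1 (u - v)).
have c2 : cvg (snd @ F : set_system K).
  apply/cauchy_cvgP/cauchyP => e /Fc[u Fu]; exists u.2.
  suff: F (snd @^-1` ball u.2 e) by [].
  apply: filterS Fu => v /=; rewrite -!ball_normE /ball_/=.
  exact/le_lt_trans/(ler_hsum_norm2 (u - v)).
move/cvg_ex: c1 => [l1 /cvgrPdist_lt Fl1]; move/cvg_ex: c2 => [l2 /cvgrPdist_lt Fl2].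
apply/cvg_ex; exists ((l1, l2) : hsum H K).
apply/cvgrPdist_lt => e e0; near=> u.
rewrite (le_lt_trans (ler_hsum_norm _))// (splitr e) ltrD//=; near: u.
  by apply: Fl1; rewrite divr_gt0.
by apply: Fl2; rewrite divr_gt0.
Unshelve. all: by end_near. Qed.

HB.instance Definition _ := Uniform_isComplete.Build (hsum H K) complete_hsum.

Definition hsum_inner (u v : hsum H K) : C := inner u.1 v.1 + inner u.2 v.2.

Let hsum_inner_bilinear :
  bilinear_for ( *%R : GRing.Scale.law C C)
    ((@Num.conj C) \; *%R : GRing.Scale.law C C) hsum_inner.
Proof.
split=> [w a u v|w a u v]; rewrite /hsum_inner/=.
  by rewrite !(linearPl inner) mulrDr addrACA.
by rewrite !(linearPr inner)/= mulrDr addrACA.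
Qed.

HB.instance Definition _ := @bilinear_isBilinear.Build C (hsum H K) (hsum H K) C
  ( *%R : GRing.Scale.law C C) ((@Num.conj C) \; *%R : GRing.Scale.law C C)
  hsum_inner hsum_inner_bilinear.

Let hsum_inner_conj u v : hsum_inner u v = (-1) ^+ false * (hsum_inner v u)^*.
Proof.
rewrite /hsum_inner expr0 mul1r rmorphD/=; congr (_ + _).
  by rewrite (@hermitian_subproof _ _ _ _ inner) expr0 mul1r.
by rewrite (@hermitian_subproof _ _ _ _ inner) expr0 mul1r.
Qed.

HB.instance Definition _ := @isHermitianSesquilinear.Build C (hsum H K) false
  (@Num.conj C) hsum_inner hsum_inner_conj.

Let hsum_inner_norm u : hsum_inner u u = `|u| ^+ 2.
Proof. by rewrite hsum_normE sqrtCK /hsum_inner !inner_norm. Qed.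

Let hsum_inner_gt0 u : u != 0 -> 0 < hsum_inner u u.
Proof. by rewrite hsum_inner_norm => u0; rewrite exprn_gt0 ?normr_gt0. Qed.

HB.instance Definition _ := @isDotProduct.Build C (hsum H K) hsum_inner
  hsum_inner_gt0.

HB.instance Definition _ := @CompleteNormedModule_isHilbert.Build C (hsum H K)
  (hsum_inner : {dot (hsum H K) for (@Num.conj C)}) hsum_inner_norm.

End HilbertSum.

HB.mixin Record isBoundedOp (C : numFieldType) (H K : normedModType C)
    (T : H -> K) := {
  op_bounded : exists M : C, forall x, `|T x| <= M * `|x|
}.

HB.structure Definition BoundedOp (C : numFieldType) (H K : normedModType C) :=
  {T of isBoundedOp C H K T & @GRing.Linear C H K *:%R T}.

Notation "{ 'bounded' H -> K }" := (@BoundedOp.type _ H%type K%type)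
  (at level 0, H at level 98, K at level 99,
   format "{ 'bounded'  H  ->  K }") : type_scope.

Section BoundedOpClosure.
Context {C : numFieldType}.

Lemma op_bound_gt0 (H K : normedModType C) (T : {bounded H -> K}) :
  exists2 M : C, 0 < M & forall x, `|T x| <= M * `|x|.
Proof.
have [M TM] := @op_bounded _ _ _ T.
exists (`|M| + 1) => [|x]; first by rewrite ltr_wpDl.
have := TM x; have [->|x0] := eqVneq x 0.
  by rewrite !linear0 !normr0 !mulr0.
move=> h; have M0 : 0 <= M.
  by rewrite -(@pmulr_lge0 _ `|x|) ?normr_gt0// (le_trans _ h).
by rewrite (le_trans h)// ler_wpM2r// ger0_norm// lerDl.
Qed.

Context {H K L : normedModType C}.

Let null_bounded : exists M : C, forall x : H, `|(\0 x : K)| <= M * `|x|.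
Proof. by exists 0 => x; rewrite mul0r normr0. Qed.
HB.instance Definition _ := isBoundedOp.Build C H K \0 null_bounded.

Let add_bounded (S T : {bounded H -> K}) :
  exists M : C, forall x, `|(S \+ T) x| <= M * `|x|.
Proof.
have [[M SM] [N TN]] := (@op_bounded _ _ _ S, @op_bounded _ _ _ T).
by exists (M + N) => x; rewrite mulrDl (le_trans (ler_normD _ _))// lerD.
Qed.
HB.instance Definition _ (S T : {bounded H -> K}) :=
  isBoundedOp.Build C H K (S \+ T) (add_bounded S T).

Let sub_bounded (S T : {bounded H -> K}) :
  exists M : C, forall x, `|(S \- T) x| <= M * `|x|.
Proof.
have [[M SM] [N TN]] := (@op_bounded _ _ _ S, @op_bounded _ _ _ T).
by exists (M + N) => x; rewrite mulrDl (le_trans (ler_normB _ _))// lerD.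
Qed.
HB.instance Definition _ (S T : {bounded H -> K}) :=
  isBoundedOp.Build C H K (S \- T) (sub_bounded S T).

Let comp_bounded (S : {bounded K -> L}) (T : {bounded H -> K}) :
  exists M : C, forall x, `|(S \o T) x| <= M * `|x|.
Proof.
have [[M M0 SM] [N TN]] := (op_bound_gt0 S, @op_bounded _ _ _ T).
by exists (M * N) => x; rewrite -mulrA (le_trans (SM _))// ler_wpM2l// ltW.
Qed.
HB.instance Definition _ (S : {bounded K -> L}) (T : {bounded H -> K}) :=
  isBoundedOp.Build C H L (S \o T) (comp_bounded S T).

End BoundedOpClosure.

Section Block.
Context {C : numClosedFieldType} {H1 H2 K1 K2 : hilbertType C}.

Definition block_op (T11 : H1 -> K1) (T12 : H2 -> K1) (T21 : H1 -> K2)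
    (T22 : H2 -> K2) (u : hsum H1 H2) : hsum K1 K2 :=
  (T11 u.1 + T12 u.2, T21 u.1 + T22 u.2).

Context (T11 : {bounded H1 -> K1}) (T12 : {bounded H2 -> K1}).
Context (T21 : {bounded H1 -> K2}) (T22 : {bounded H2 -> K2}).

Let block_linear : linear (block_op T11 T12 T21 T22).
Proof.
move=> a u v; rewrite [RHS]surjective_pairing; congr (_, _); rewrite /block_op/=.
  by rewrite !linearP scalerDr addrACA.
by rewrite !linearP scalerDr addrACA.
Qed.
HB.instance Definition _ := GRing.isLinear.Build C (hsum H1 H2) (hsum K1 K2) *:%R
  (block_op T11 T12 T21 T22) block_linear.

Let block_bounded :
  exists M : C, forall u, `|block_op T11 T12 T21 T22 u| <= M * `|u|.
Proof.
have [M11 M11_0 b11] := op_bound_gt0 T11; have [M12 M12_0 b12] := op_bound_gt0 T12.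
have [M21 M21_0 b21] := op_bound_gt0 T21; have [M22 M22_0 b22] := op_bound_gt0 T22.
exists (M11 + M12 + (M21 + M22)) => u.
rewrite (le_trans (ler_hsum_norm _))//= 3!mulrDl.
have h1 := ler_hsum_norm1 u; have h2 := ler_hsum_norm2 u.
apply: lerD; apply: (le_trans (ler_normD _ _)); apply: lerD.
- by apply: (le_trans (b11 _)); rewrite ler_pM2l.
- by apply: (le_trans (b12 _)); rewrite ler_pM2l.
- by apply: (le_trans (b21 _)); rewrite ler_pM2l.
- by apply: (le_trans (b22 _)); rewrite ler_pM2l.
Qed.
HB.instance Definition _ := isBoundedOp.Build C (hsum H1 H2) (hsum K1 K2)
  (block_op T11 T12 T21 T22) block_bounded.

End Block.

Section InnerTheory.
Context {C : numClosedFieldType} {H : hilbertType C}.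
Implicit Types x y z : H.

Lemma inner_conj x y : inner x y = (inner y x)^*.
Proof. by rewrite (@hermitian_subproof _ _ _ _ inner) expr0 mul1r. Qed.

Lemma inner_inj y z : (forall x, inner x y = inner x z) -> y = z.
Proof.
move=> yz; apply/eqP; rewrite -subr_eq0 -(dnorm_eq0 inner).
by rewrite (linearBr inner) subr_eq0; apply/eqP; exact: yz.
Qed.

Lemma ler_inner x y : `|inner x y| <= `|x| * `|y|.
Proof.
have [->|y0] := eqVneq y 0; first by rewrite (linear0r inner) !normr0 mulr0.
have Y0 : 0 < `|y| by rewrite normr_gt0.
set b := `|y| ^+ 2; set c := inner x y.
have bJ : b^* = b by rewrite rmorphXn/= (CrealP (normr_real y)).
have : 0 <= `|b *: x - c *: y| ^+ 2 by rewrite exprn_ge0.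
have -> : `|b *: x - c *: y| ^+ 2 = b * (`|x| ^+ 2 * b - `|c| ^+ 2).
  rewrite -inner_norm (linearBl inner) !(linearBr inner).
  rewrite !(linearZl_LR inner) !(linearZr_LR inner)/= !inner_norm.
  rewrite (inner_conj y x) bJ -/b -/c normCK; ring.
rewrite pmulr_rge0 ?exprn_gt0// subr_ge0 -exprMn.
by rewrite ler_pXn2r ?nnegrE// mulr_ge0.
Qed.

End InnerTheory.

(* The junk value returned by get is never taken when T is bounded and the
   scalars are R[i]: see adjointP. *)
Definition adjoint (C : numClosedFieldType) (H K : hilbertType C) (T : H -> K)
    (y : K) : H :=
  get [set z | forall x, inner (T x) y = inner x z].

Section Riesz.
Context {R : realType} {H : hilbertType R[i]}.
Implicit Types x y z : H.
Local Notation Re := (@complex.Re R).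
Local Notation rnorm x := (Re `|x|).

Let rnormE (V : normedModType R[i]) (x : V) : (rnorm x)%:C%C = `|x|.
Proof. by rewrite RRe_real ?normr_real. Qed.

Let rnorm_ge0 (V : normedModType R[i]) (x : V) : 0 <= rnorm x.
Proof. by rewrite -lecR rnormE; exact: normr_ge0. Qed.

Let Re_real_mul (t : R) (c : R[i]) : Re (t%:C%C * c) = t * Re c.
Proof. by case: c => a b /=; rewrite mul0r subr0. Qed.

Let ler_Re_norm (c : R[i]) : `|Re c| <= rnorm c.
Proof. by rewrite -lecR RRe_real ?normr_real// normc_ge_Re. Qed.

Let ReD (c d : R[i]) : Re (c + d) = Re c + Re d.
Proof. by case: c d => [? ?] [? ?]. Qed.

Let rdot x y : R := Re (inner x y).

Let rdotC x y : rdot x y = rdot y x.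
Proof. by rewrite /rdot inner_conj; case: (inner y x). Qed.

Let rdotDl x y z : rdot (x + y) z = rdot x z + rdot y z.
Proof. rewrite /rdot (linearDl inner)/=; exact: ReD. Qed.

Let rdotDr x y z : rdot z (x + y) = rdot z x + rdot z y.
Proof. by rewrite rdotC rdotDl !(rdotC z). Qed.

Let rdotZl (t : R) x y : rdot (t%:C%C *: x) y = t * rdot x y.
Proof. by rewrite /rdot (linearZl_LR inner)/= Re_real_mul. Qed.

Let rdotZr (t : R) x y : rdot x (t%:C%C *: y) = t * rdot x y.
Proof. by rewrite rdotC rdotZl rdotC. Qed.

Let rdot_ge0 x : 0 <= rdot x x.
Proof.
by rewrite /rdot inner_norm -rnormE -rmorphXn/= exprn_ge0.
Qed.

Let ler_rdot x y : `|rdot x y| <= rnorm x * rnorm y.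
Proof.
rewrite (le_trans (ler_Re_norm _))// -lecR rmorphM/= !rnormE.
exact: ler_inner.
Qed.

Context (phi : H -> R[i]) (m : R).
Context (phiP : forall a x y, phi (a *: x + y) = a * phi x + phi y).
Context (phi_bounded : forall x, `|phi x| <= m%:C%C * `|x|).

Let f x : R := Re (phi x).

Let fP (t : R) x y : f (t%:C%C *: x + y) = t * f x + f y.
Proof. by rewrite /f phiP ReD Re_real_mul. Qed.

Let f_bound x : `|f x| <= m * rnorm x.
Proof.
rewrite (le_trans (ler_Re_norm _))// -lecR rmorphM/= !rnormE.
exact: phi_bounded.
Qed.

Let J x := rdot x x - 2 * f x.

Let J_lbound x : - m ^+ 2 <= J x.
Proof.
have := f_bound x; rewrite ler_norml => /andP[_ fx].
have -> : J x = rnorm x ^+ 2 - 2 * f x.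
  by rewrite /J /rdot inner_norm -rnormE -rmorphXn.
by have := sqr_ge0 (rnorm x - m); nra.
Qed.

Let I := inf (range J).

Let I_le x : I <= J x.
Proof.
apply: ge_inf; last by exists x.
by exists (- m ^+ 2) => _ [y _ <-]; exact: J_lbound.
Qed.

Let JP (t : R) x v :
  J (t%:C%C *: v + x) = J x + 2 * t * (rdot v x - f v) + t ^+ 2 * rdot v v.
Proof.
rewrite /J fP !(rdotDl, rdotDr, rdotZl, rdotZr) (rdotC x v); ring.
Qed.

Let near_min (e : R) x y : J x < I + e -> J y < I + e ->
  rdot (y - x) (y - x) < 4 * e.
Proof.
move=> xe ye.
have := I_le ((2^-1)%:C%C *: (y - x) + x); rewrite JP.
have : J y = J x + 2 * (rdot (y - x) x - f (y - x)) + rdot (y - x) (y - x).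
  by have := JP 1 x (y - x); rewrite scale1r subrK mulr1 expr1n mul1r.
set q := rdot _ _; set p := _ - f _ => Jy h.
by move: h; lra.
Qed.

Lemma riesz : exists z, forall x, phi x = inner x z.
Proof.
pose F := filter_from [set e : R | 0 < e] (fun e => [set x | J x < I + e]).
have FF : ProperFilter F.
  apply: filter_from_proper => [|e e0].
    apply: filter_from_filter; first by exists 1; exact: ltr01.
    move=> d e d0 e0; exists (Num.min d e); first by rewrite /= lt_min; apply/andP; split.
    move=> x /=; rewrite -!ltrBlDl lt_min => /andP[xd xe].
    by split; move: xd xe; rewrite !ltrBlDl.
  have [|_ [x _ <-]] := @inf_adherent _ (range J) e e0; last by exists x.
  split; first by exists (J 0), 0.
  by exists (- m ^+ 2) => _ [y _ <-]; exact: J_lbound.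
have Fe e : 0 < e -> F [set x | J x < I + e] by move=> e0; exists e.
have : cvg F.
  apply/cauchy_cvgP/cauchyP => e e0.
  have er : (Re e)%:C%C = e by rewrite RRe_real ?gtr0_real.
  have e0' : 0 < Re e by rewrite -ltcR er.
  have d0 : 0 < Re e ^+ 2 / 4 by rewrite divr_gt0 ?exprn_gt0.
  have [x Jx] := filter_ex (Fe _ d0).
  exists x; exists (Re e ^+ 2 / 4) => // y Jy.
  rewrite -ball_normE /ball_/=.
  have := near_min Jy Jx; rewrite mulrC divfK ?pnatr_eq0//.
  rewrite /rdot inner_norm -rnormE -rmorphXn/= -[in X in _ -> X]er ltcR.
  by rewrite ltr_pXn2r ?nnegrE// ltW.
move=> /cvg_ex[z zF].
have Fz (e : R[i]) : 0 < e -> F [set x | `|z - x| < e].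
  by move=> e0; apply: (@cvgr_dist_lt _ _ _ F _ id z zF).
have key v : rdot v z = f v.
  apply/eqP; rewrite -subr_eq0; apply/negPn/negP => d0.
  set D := rdot v z - f v in d0.
  pose k := 1 + rdot v v + rnorm v.
  have k0 : 0 < k.
    by rewrite /k ltr_wpDr ?rnorm_ge0// ltr_wpDr ?rdot_ge0// ltr01.
  pose s := `|D| / (2 * k).
  have s0 : 0 < s by rewrite divr_gt0 ?normr_gt0 ?mulr_gt0.
  have [x [Jx zx]] : exists x, J x < I + s ^+ 2 /\ rnorm (z - x) < s.
    have Fs : F [set x | J x < I + s ^+ 2] by apply: Fe; exact: exprn_gt0.
    have Fz' := Fz s%:C%C; rewrite ltcR in Fz'.
    have [x [/= xs zx]] := filter_ex (filterI Fs (Fz' s0)).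
    by exists x; split=> //; rewrite -ltcR rnormE.
  have h1 := I_le (s%:C%C *: v + x); have h2 := I_le ((- s)%:C%C *: v + x).
  rewrite JP in h1; rewrite JP in h2.
  have h3 : `|rdot v x - f v| <= s * (1 + rdot v v).
    have hp : 2 * (rdot v x - f v) >= - (s * (1 + rdot v v)).
      by rewrite -(ler_pM2l s0); nra.
    have hm : 2 * (rdot v x - f v) <= s * (1 + rdot v v).
      by rewrite -(ler_pM2l s0); nra.
    have : 0 <= s * (1 + rdot v v).
      by apply: mulr_ge0; [exact: ltW|rewrite addr_ge0 ?rdot_ge0 ?ler01].

    by rewrite ler_norml => ?; apply/andP; split; lra.
  have h4 : `|rdot v (z - x)| <= s * rnorm v.
    apply: le_trans (ler_rdot _ _) _; rewrite mulrC.
    by apply: ler_wpM2r; [exact: rnorm_ge0|exact: ltW].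
  have : `|D| <= s * k.
    have -> : D = (rdot v x - f v) + rdot v (z - x).
      have zE : z = x + (z - x) by rewrite addrC subrK.
      by rewrite /D [in LHS]zE rdotDr addrAC.
    by rewrite (le_trans (ler_normD _ _))// /k mulrDr lerD.
  rewrite /s invfM mulrA divfK ?gt_eqF//.
  have : 0 < `|D| by rewrite normr_gt0.
  lra.
exists z => x; apply/eqP; rewrite eq_complex; apply/andP; split; apply/eqP.
  by rewrite -[RHS]/(rdot x z) key.
have := key ('i%C *: x); rewrite /rdot /f (linearZl_LR inner)/=.
rewrite -[_ *: x]addr0 phiP (_ : phi 0 = 0) ?addr0.
  rewrite mulrC ReiNIm [X in _ = complex.Re X]mulrC ReiNIm => /oppr_inj.
  by move=> ->.
have := phiP (-1) 0 0; rewrite scaler0 addr0 mulN1r => ->.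
by rewrite addNr.
Qed.

End Riesz.

Section Adjoint.
Context {R : realType} {H K : hilbertType R[i]} (T : {bounded H -> K}).

Lemma adjointP x y : inner (T x) y = inner x (adjoint T y).
Proof.
have [M M0 TM] := op_bound_gt0 T.
suff [z zP] : exists z, forall x, inner (T x) y = inner x z.
  by have := @getPex _ [set z | forall x, inner (T x) y = inner x z]; apply; exists z.
have Mr : (complex.Re (M * `|y|))%:C%C = M * `|y|.
  by rewrite RRe_real// ger0_real// mulr_ge0// ltW.
apply: (@riesz _ _ (fun x => inner (T x) y) (complex.Re (M * `|y|))).
  by move=> a u v; rewrite linearP (linearPl inner).
move=> u; rewrite Mr (le_trans (ler_inner _ _))// mulrAC.
by rewrite ler_wpM2r.
Qed.

Let adjoint_linear : linear (adjoint T).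
Proof.
move=> a u v; apply: inner_inj => x.
by rewrite -adjointP !(linearPr inner)/= !adjointP.
Qed.
HB.instance Definition _ := GRing.isLinear.Build R[i] K H *:%R
  (adjoint T) adjoint_linear.

Let adjoint_bounded : exists M : R[i], forall y, `|adjoint T y| <= M * `|y|.
Proof.
have [M M0 TM] := op_bound_gt0 T; exists M => y.
have [->|n0] := eqVneq (adjoint T y) 0; first by rewrite normr0 mulr_ge0// ltW.
rewrite -(@ler_pM2r _ `|adjoint T y|) ?normr_gt0// -expr2.
have -> : `|adjoint T y| ^+ 2 = `|inner (T (adjoint T y)) y|.
  by rewrite adjointP inner_norm ger0_norm ?exprn_ge0.
by rewrite (le_trans (ler_inner _ _))// mulrAC ler_wpM2r.
Qed.
HB.instance Definition _ := isBoundedOp.Build R[i] K H (adjoint T) adjoint_bounded.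

End Adjoint.

(* Norms over R[i] are valued in R[i], hence the real parts. On the zero space
   the unit sphere is empty and both suprema are 0 (sup set0 = 0). *)
Definition opnorm (R : realType) (H K : normedModType R[i]) (T : H -> K) : R :=
  sup [set complex.Re `|T x| | x in [set x : H | `|x| = 1]].

Definition numradius (R : realType) (H : hilbertType R[i]) (T : H -> H) : R :=
  sup [set complex.Re `|inner (T x) x| | x in [set x : H | `|x| = 1]].

(* Main.v *)
Require Import Defs.
From HB Require Import structures.
From mathcomp Require Import all_boot all_order all_algebra.
From mathcomp Require Import sesquilinear complex.
From mathcomp Require Import all_classical all_reals topology normedtype.
From mathcomp Require Import ring lra.

Set Implicit Arguments.
Unset Strict Implicit.
Unset Printing Implicit Defensive.

Import Order.TTheory GRing.Theory Num.Theory.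
Import numFieldNormedType.Exports.

Local Open Scope classical_set_scope.
Local Open Scope ring_scope.

(** Write [w] for the numerical radius of the off-diagonal block operator with
    entries [X] and [Y].  The proof bounds [X + c Y] for every unimodular [c];
    the sum and the difference are [c = 1] and [c = -1], and the product form is
    [X = A B], [Y = C D], [Y^* = D^* C^*].

    Given a unit vector [x], choose a unimodular [l] that makes
    [l <(X + c Y) x, x>] real and nonnegative.  Since
    [<l c Y x, x>] and [<m Y^* x, x>], where [m] is the conjugate of [l c], have
    the same real part,
      [|<(X + c Y) x, x>| = Re <T x, x>] with [T = l X + m Y^*].
    So the numerical range of [X + c Y] is governed by the operators [T], and
    three facts about them give the claim:

    - [Re <T x, x> <= (|T| + sqrt |T^2|) / 2], Kittaneh's inequality
      ([rdot_le_opnorm_sqr]);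
    - [|T| <= 2 w] ([opnorm_combination_le]): evaluating the quadratic form of
      the block operator at [(p, k q)] for a suitable unimodular [k] produces
      [Re <T q, p>], while [|(p, k q)|^2 = |p|^2 + |q|^2];
    - [T^2 = l^2 X^2 + m^2 (Y^* )^2 + l m (X Y^* + Y^* X)] has norm at most the
      quantity under the square root.

    Kittaneh's inequality is usually derived from a mixed Schwarz inequality for
    [|T|] and [|T^*|].  The argument here needs no functional calculus.  Let [t]
    be the supremum of the numerical range of [S = T + T^*], and suppose that it
    is attained at a unit vector [y], so that [S y = t y].  Then
    [t T y = T^2 y + T T^* y] and [t T^* y = T^* T y + (T^* )^2 y], hence, with
    [a = |T|] and [b^2 = |T^2|],
      [t (|T y| + |T^* y|) <= 2 b^2 + a (|T y| + |T^* y|)].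
    As [|T y| + |T^* y| >= t], either [t <= a] or [t (t - a) <= 2 b^2], and
    because [b <= a] the latter forces [t <= a + b].  In infinite dimension [y]
    is replaced by approximate eigenvectors, which exist by
    [rnorm_form_defect]. *)

Local Notation rnorm x := (complex.Re `|x|).
Local Notation rdot x y := (complex.Re (inner x y)).

(** * Real parts, norms and inner products valued in R *)

Section ComplexParts.
Context {R : realType}.
Implicit Types c d : R[i].

Lemma ReD c d : complex.Re (c + d) = complex.Re c + complex.Re d.
Proof. by case: c d => [? ?] [? ?]. Qed.

Lemma ReN c : complex.Re (- c) = - complex.Re c.
Proof. by case: c. Qed.

Lemma Re_realM (t : R) c : complex.Re (t%:C%C * c) = t * complex.Re c.
Proof. by case: c => a b /=; rewrite mul0r subr0. Qed.

Lemma complexRe_conj c : complex.Re c^* = complex.Re c.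
Proof. by case: c. Qed.

Lemma ler_Re_norm c : complex.Re c <= rnorm c.
Proof.
by rewrite (le_trans (ler_norm _))// -lecR RRe_real ?normr_real// normc_ge_Re.
Qed.

Lemma unimodular_conj c : `|c| = 1 -> `|c^*| = 1.
Proof. by rewrite norm_conjC. Qed.

Lemma unimodularK c : `|c| = 1 -> c^* * c = 1.
Proof. by move=> c1; rewrite -normCKC c1 expr1n. Qed.

Lemma unimodular_rotate c : exists2 d : R[i], `|d| = 1 & d * c = `|c|.
Proof.
have [->|c0] := eqVneq c 0; first by exists 1; rewrite ?normr1// mulr0 normr0.
have n0 : `|c| != 0 by rewrite normr_eq0.
exists (c^* / `|c|).
  by rewrite normrM normfV normr_id norm_conjC divff.
by rewrite mulrAC -normCKC expr2 mulfK.
Qed.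

End ComplexParts.

Section RealNorm.
Context {R : realType} {V : normedModType R[i]}.
Implicit Types x y : V.

Lemma rnormE x : (rnorm x)%:C%C = `|x|.
Proof. by rewrite RRe_real ?normr_real. Qed.

Lemma rnorm_ge0 x : 0 <= rnorm x.
Proof. by rewrite -lecR rnormE; exact: normr_ge0. Qed.

Lemma rnorm_gt0 x : x != 0 -> 0 < rnorm x.
Proof. by move=> x0; rewrite -ltcR rnormE normr_gt0. Qed.

Lemma rnorm0 : rnorm (0 : V) = 0.
Proof. by rewrite normr0. Qed.

Lemma ler_rnormD x y : rnorm (x + y) <= rnorm x + rnorm y.
Proof. by rewrite -lecR rmorphD/= !rnormE ler_normD. Qed.

Lemma rnormN x : rnorm (- x) = rnorm x.
Proof. by rewrite normrN. Qed.

Lemma rnormZr (t : R) x : 0 <= t -> rnorm (t%:C%C *: x) = t * rnorm x.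
Proof. by move=> t0; rewrite normrZ ger0_norm ?lecR// Re_realM. Qed.

Lemma rnormZ_unimodular (c : R[i]) x : `|c| = 1 -> rnorm (c *: x) = rnorm x.
Proof. by move=> c1; rewrite normrZ c1 mul1r. Qed.

Lemma rnorm_normalize x : x != 0 ->
  exists2 y : V, `|y| = 1 & x = (rnorm x)%:C%C *: y.
Proof.
move=> x0; have n0 : `|x| != 0 by rewrite normr_eq0.
exists (`|x|^-1 *: x); last by rewrite rnormE scalerA divff// scale1r.
by rewrite normrZ normfV normr_id mulVf.
Qed.

End RealNorm.

Section RealDot.
Context {R : realType} {H : hilbertType R[i]}.
Implicit Types x y z : H.

Lemma rdotC x y : rdot x y = rdot y x.
Proof. by rewrite inner_conj complexRe_conj. Qed.

Lemma rdotDl x y z : rdot (x + y) z = rdot x z + rdot y z.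
Proof. by rewrite (linearDl inner) ReD. Qed.

Lemma rdotDr x y z : rdot z (x + y) = rdot z x + rdot z y.
Proof. by rewrite rdotC rdotDl !(rdotC z). Qed.

Lemma rdotNl x y : rdot (- x) y = - rdot x y.
Proof. by rewrite (linearNl inner) ReN. Qed.

Lemma rdotNr x y : rdot x (- y) = - rdot x y.
Proof. by rewrite rdotC rdotNl rdotC. Qed.

Lemma rdotZl (t : R) x y : rdot (t%:C%C *: x) y = t * rdot x y.
Proof. by rewrite (linearZl_LR inner) Re_realM. Qed.

Lemma rdotZr (t : R) x y : rdot x (t%:C%C *: y) = t * rdot x y.
Proof. by rewrite rdotC rdotZl rdotC. Qed.

Lemma rdotxx x : rdot x x = rnorm x ^+ 2.
Proof. by rewrite inner_norm -rnormE -rmorphXn. Qed.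

Lemma ler_rinner x y : rnorm (inner x y) <= rnorm x * rnorm y.
Proof. by rewrite -lecR rmorphM/= !rnormE ler_inner. Qed.

Lemma ler_rdot x y : rdot x y <= rnorm x * rnorm y.
Proof. exact: le_trans (ler_Re_norm _) (ler_rinner _ _). Qed.

End RealDot.

(** * Suprema over the unit sphere, operator norm and numerical radius *)

Section SphereSup.
Context {R : realType} {V : normedModType R[i]}.
Implicit Types (f : V -> R) (M : R).

(** The bound must be nonnegative because the sphere of the zero space is
    empty, in which case the supremum is [0]. *)
Lemma sphere_sup_le f M : 0 <= M -> (forall x, `|x| = 1 -> f x <= M) ->
  sup [set f x | x in [set x : V | `|x| = 1]] <= M.
Proof.
move=> M0 fM; have [->|E0] := eqVneq [set f x | x in [set x : V | `|x| = 1]] set0.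
  by rewrite sup0.
by apply: ge_sup; [exact/set0P|move=> _ [x x1 <-]; exact: fM].
Qed.

Lemma le_sphere_sup f M x : (forall x, `|x| = 1 -> f x <= M) -> `|x| = 1 ->
  f x <= sup [set f x | x in [set x : V | `|x| = 1]].
Proof.
by move=> fM x1; apply: ub_le_sup; [exists M => _ [y y1 <-]; exact: fM|exists x].
Qed.

(** Boundedness of [f] is not required: [sup] takes the value [0] on sets
    without a supremum. *)
Lemma sphere_sup_ge0 f : (forall x, 0 <= f x) ->
  0 <= sup [set f x | x in [set x : V | `|x| = 1]].
Proof.
move=> f0; have [hs|/sup_out->//] := pselect (has_sup [set f x | x in [set x : V | `|x| = 1]]).
have [[r Er] ub] := hs; apply: (@le_trans _ _ r); last exact: ub_le_sup.
by case: Er => x _ <-.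
Qed.

End SphereSup.

Section OperatorNorm.
Context {R : realType} {H K : normedModType R[i]}.
Implicit Type T : {bounded H -> K}.

Lemma opnorm_ge0 (T : H -> K) : 0 <= opnorm T.
Proof. by apply: sphere_sup_ge0 => x; exact: rnorm_ge0. Qed.

Lemma opnorm_le (T : H -> K) (M : R) : 0 <= M ->
  (forall x, rnorm (T x) <= M * rnorm x) -> opnorm T <= M.
Proof.
by move=> M0 TM; apply: sphere_sup_le => // x x1; rewrite (le_trans (TM x))// x1 mulr1.
Qed.

Lemma ler_opnorm T x : rnorm (T x) <= opnorm T * rnorm x.
Proof.
have [->|/rnorm_normalize[y y1 ->]] := eqVneq x 0.
  by rewrite linear0 !rnorm0 mulr0.
rewrite linearZ/= !rnormZr ?rnorm_ge0// y1 mulr1 mulrC.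
apply: ler_wpM2r; first exact: rnorm_ge0.
have [M M0 TM] := op_bound_gt0 T.
apply: (@le_sphere_sup _ _ (fun y => rnorm (T y)) (complex.Re M)) => // z z1.
have := TM z; rewrite z1 mulr1 -rnormE -[M in _ <= M]RRe_real ?gtr0_real//.
by rewrite lecR.
Qed.

End OperatorNorm.

Section NumericalRadius.
Context {R : realType} {H : hilbertType R[i]}.
Implicit Type T : {bounded H -> H}.

Lemma numradius_ge0 (T : H -> H) : 0 <= numradius T.
Proof. by apply: sphere_sup_ge0 => x; exact: rnorm_ge0. Qed.

Lemma ler_numradius T x :
  rnorm (inner (T x) x) <= numradius T * rnorm x ^+ 2.
Proof.
have [->|/rnorm_normalize[y y1 xE]] := eqVneq x 0.
  by rewrite (linear0r inner) !normr0 expr0n mulr0.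
have : 0 <= rnorm x by exact: rnorm_ge0.
move: xE; move: (rnorm x) => c -> c0.
have -> : inner (T (c%:C%C *: y)) (c%:C%C *: y) = (c ^+ 2)%:C%C * inner (T y) y.
  rewrite [T _]linearZ (linearZl_LR inner) (linearZr_LR inner)/= mulrA.
  by rewrite rmorphXn expr2/= (_ : _^* = c%:C%C)//; apply/CrealP; rewrite ger0_real ?lecR.
rewrite normrM ger0_norm ?lecR ?exprn_ge0// Re_realM mulrC.
apply: ler_wpM2r; first exact: exprn_ge0.
apply: (@le_sphere_sup _ _ (fun y => rnorm (inner (T y) y)) (opnorm T)) => // z z1.
by rewrite (le_trans (ler_rinner _ _))// z1 mulr1 (le_trans (ler_opnorm _ _))// z1 mulr1.
Qed.

End NumericalRadius.

Section AdjointNorm.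
Context {R : realType} {H K L : hilbertType R[i]}.

Lemma opnorm_adjoint_le (T : {bounded H -> K}) : opnorm (adjoint T) <= opnorm T.
Proof.
apply: opnorm_le => [|y]; first exact: opnorm_ge0.
have [->|n0] := eqVneq (adjoint T y) 0.
  by rewrite rnorm0 mulr_ge0 ?opnorm_ge0 ?rnorm_ge0.
rewrite -(ler_pM2r (rnorm_gt0 n0)) -expr2 -rdotxx -adjointP.
rewrite (le_trans (ler_rdot _ _))// mulrAC ler_wpM2r ?rnorm_ge0//.
exact: ler_opnorm.
Qed.

Lemma adjoint_comp (S : {bounded K -> L}) (T : {bounded H -> K}) :
  adjoint (S \o T) = adjoint T \o adjoint S.
Proof.
by apply/funext => y; apply: inner_inj => x; rewrite -adjointP/= !adjointP.
Qed.

End AdjointNorm.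

Section Scale.
Context {C : numFieldType} {H K : normedModType C}.

Let scale_bounded (a : C) (T : {bounded H -> K}) :
  exists M : C, forall x, `|(a \*: T) x| <= M * `|x|.
Proof.
have [M TM] := @op_bounded _ _ _ T.
by exists (`|a| * M) => x; rewrite /= normrZ -mulrA ler_wpM2l.
Qed.
HB.instance Definition _ (a : C) (T : {bounded H -> K}) :=
  isBoundedOp.Build C H K (a \*: T) (scale_bounded a T).

End Scale.

(** * Kittaneh's inequality *)

Section Kittaneh.
Context {R : realType} {H : hilbertType R[i]}.

(** Vectors that nearly maximise the form of [S] are nearly eigenvectors:
    [P = t - S] is nonnegative and bounded by [M], and for such an operator
    [|P x|^2 <= M <P x, x>], as one sees by evaluating the form of [P] at
    [x - P x / M]. *)
Lemma rnorm_form_defect (S : {bounded H -> H}) (t : R) :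
  (forall x y, inner (S x) y = inner x (S y)) ->
  (forall x, rdot (S x) x <= t * rnorm x ^+ 2) ->
  exists2 M : R, 0 < M & forall x,
    rnorm (t%:C%C *: x - S x) ^+ 2 <= M * (t * rnorm x ^+ 2 - rdot (S x) x).
Proof.
move=> Ssym St.
exists (`|t| + opnorm S + 1) => [|x].
  by rewrite ltr_wpDl ?addr_ge0 ?opnorm_ge0.
set M := _ + 1; have M0 : 0 < M by rewrite ltr_wpDl ?addr_ge0 ?opnorm_ge0.
set y := _ - _.
have qy : t * rnorm y ^+ 2 - rdot (S y) y <= M * rnorm y ^+ 2.
  have : rdot (- S y) y <= opnorm S * rnorm y ^+ 2.
    rewrite (le_trans (ler_rdot _ _))// rnormN expr2 mulrA.
    by rewrite ler_wpM2r ?rnorm_ge0 ?ler_opnorm.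
  rewrite rdotNl => h; have := ler_norm t; have := sqr_ge0 (rnorm y).
  rewrite /M; nra.
have xy : t * rdot x y - rdot (S x) y = rnorm y ^+ 2.
  by rewrite -rdotxx {3}/y rdotDl rdotNl rdotZl.
(* The vector x - y / M scaled by M, to avoid the division. *)
clearbody y; have := St (M%:C%C *: x - y).
rewrite -rdotxx (_ : S (M%:C%C *: x - y) = M%:C%C *: S x - S y); last by rewrite linearB linearZ.
rewrite !(rdotDl, rdotDr, rdotNl, rdotNr, rdotZl, rdotZr).
rewrite (rdotC y x) (_ : rdot (S y) x = rdot (S x) y); last first.
  by rewrite rdotC Ssym.
rewrite !rdotxx => h; rewrite -(ler_pM2l M0).
move: qy xy h; set a := rnorm y ^+ 2; set q := rdot (S y) y.
set u := rdot x y; set v := rdot (S x) y; set w := rdot (S x) x.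
set n := rnorm x ^+ 2 => qy xy h.
have Mxy : M * (t * u - v) = M * a by rewrite xy.
nra.
Qed.

(** Kittaneh's inequality for the real part; the other phases follow by rotating
    [T].  It comes from
    [t (|T y| + |T^* y|) <= 2 b^2 + a (|T y| + |T^* y|)] at near eigenvectors
    [y] of [T + T^*]. *)
Lemma rdot_le_opnorm_sqr (T : {bounded H -> H}) x : `|x| = 1 ->
  rdot (T x) x <= 2^-1 * (opnorm T + Num.sqrt (opnorm (T \o T))).
Proof.
move=> x1; set a := opnorm T; set b := Num.sqrt _.
have a0 : 0 <= a by exact: opnorm_ge0.
have b0 : 0 <= b by exact: sqrtr_ge0.
have b2 : b ^+ 2 = opnorm (T \o T) by rewrite sqr_sqrtr ?opnorm_ge0.
pose S := T \+ adjoint T.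
have Ssym u v : inner (S u) v = inner u (S v).
  rewrite /S/= (linearDl inner) (linearDr inner)/= adjointP addrC; congr (_ + _).
  by rewrite inner_conj -adjointP -inner_conj.
have Sdot u : rdot (S u) u = 2 * rdot (T u) u.
  by rewrite /S/= rdotDl (rdotC (adjoint T u)) -adjointP mulr_natl mulr2n.
pose t := sup [set rdot (S u) u | u in [set u : H | `|u| = 1]].
have Sub u : `|u| = 1 -> rdot (S u) u <= 2 * a.
  move=> u1; rewrite Sdot ler_pM2l// (le_trans (ler_rdot _ _))// u1 mulr1.
  by rewrite (le_trans (ler_opnorm _ _))// u1 mulr1.
have tub u : `|u| = 1 -> rdot (S u) u <= t.
  by move=> u1; exact: (@le_sphere_sup _ _ (fun u => rdot (S u) u) _ _ Sub).
suff : t <= a + b by have := tub x x1; rewrite Sdot; lra.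
have t2a : t <= 2 * a by apply: sphere_sup_le => //; rewrite mulr_ge0.
have [ab|ba] := lerP a b; first lra.
have [ta|lt_at] := lerP t a; first lra.
suff : (t - a) * t <= 2 * b ^+ 2.
  by move=> h; rewrite leNgt; apply/negP => tab; clear x1; nra.
have St u : rdot (S u) u <= t * rnorm u ^+ 2.
  have [->|/rnorm_normalize[y y1 ->]] := eqVneq u 0.
    by rewrite (linear0r inner) rnorm0 expr0n mulr0.
  rewrite [S _]linearZ/= rdotZl rdotZr rnormZr ?rnorm_ge0// y1 mulr1 mulrA -expr2.
  by rewrite mulrC ler_wpM2r ?tub// exprn_ge0 ?rnorm_ge0.
have [M M0 SM] := rnorm_form_defect Ssym St.
(* The inequality at a unit vector y with |t y - S y| <= d. *)
have step (d : R) : 0 < d -> (t - a) * t <= 2 * b ^+ 2 + (t + a) * d.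
  move=> d0.
  have [_ [y y1 <-] yt] : exists2 r, [set rdot (S u) u | u in [set u : H | `|u| = 1]] r & t - d ^+ 2 / M < r.
    apply: sup_adherent; first by rewrite divr_gt0 ?exprn_gt0.
    by split; [exists (rdot (S x) x), x|exists (2 * a) => _ [u u1 <-]; exact: Sub].
  have dy : rnorm (t%:C%C *: y - S y) <= d.
    rewrite -(@ler_pXn2r _ 2) ?nnegrE ?rnorm_ge0 ?(ltW d0)//.
    rewrite (le_trans (SM y))// y1 expr1n mulr1.
    by rewrite mulrC -ler_pdivlMr// lerBlDl -lerBlDr ltW.
  set r := _ - _ in dy; have tE : t%:C%C *: y = T y + adjoint T y + r by rewrite addrC subrK.
  clearbody r.
  have t0 : 0 <= t by lra.
  have tn : t <= rnorm (T y) + rnorm (adjoint T y) + d.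
    have <- : rnorm (t%:C%C *: y) = t by rewrite rnormZr// y1 mulr1.
    by rewrite tE (le_trans (ler_rnormD _ _))// lerD// ler_rnormD.
  have adj1 u : rnorm (adjoint T u) <= a * rnorm u.
    rewrite (le_trans (ler_opnorm _ _))// ler_wpM2r ?rnorm_ge0//.
    exact: opnorm_adjoint_le.
  have TT : rnorm (T (T y)) <= b ^+ 2.
    by rewrite b2 (le_trans (ler_opnorm (T \o T) _))// y1 mulr1.
  have AA : rnorm (adjoint T (adjoint T y)) <= b ^+ 2.
    rewrite -[adjoint T _]/((adjoint T \o adjoint T) y) -adjoint_comp b2.
    rewrite (le_trans (ler_opnorm _ _))// y1 mulr1; exact: opnorm_adjoint_le.
  have h1 : t * rnorm (T y) <= b ^+ 2 + a * rnorm (adjoint T y) + a * d.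
    rewrite -rnormZr// -linearZ tE !linearD/=.
    rewrite (le_trans (ler_rnormD _ _))// lerD//.
      by rewrite (le_trans (ler_rnormD _ _))// lerD// ler_opnorm.
    by rewrite (le_trans (ler_opnorm _ _))// ler_wpM2l.
  have h2 : t * rnorm (adjoint T y) <= b ^+ 2 + a * rnorm (T y) + a * d.
    rewrite -rnormZr// -linearZ tE !linearD/=.
    rewrite (le_trans (ler_rnormD _ _))// lerD//.
      by rewrite addrC (le_trans (ler_rnormD _ _))// lerD.
    by rewrite (le_trans (adj1 _))// ler_wpM2l.
  clear x1 y1; nra.
(* Letting d tend to 0: this d makes (t + a) d half of the alleged gap. *)
rewrite leNgt; apply/negP => lt_t.
have ta0 : 0 < t + a by lra.
pose d := ((t - a) * t - 2 * b ^+ 2) / (2 * (t + a)).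
have d0 : 0 < d by rewrite divr_gt0 ?mulr_gt0// subr_gt0.
have := step d d0.
have -> : (t + a) * d = ((t - a) * t - 2 * b ^+ 2) / 2.
  by rewrite /d; field; rewrite gt_eqF.
lra.
Qed.

End Kittaneh.

(** * The off-diagonal block operator *)

Section Block.
Context {R : realType} {H : hilbertType R[i]}.
Implicit Types X Y : {bounded H -> H}.

(** With [k^2 = a b], the numbers [k <X q, p> + k^* <Y p, q>] (the form of the
    block operator at [(p, k q)]) and [a <X q, p> + b^* <Y p, q>] differ by the
    unimodular factor [a k^*], and the latter has the real part of
    [<(a X + b Y^* ) q, p>]. *)
Lemma rdot_offdiag_le X Y (a b : R[i]) (p q : H) : `|a| = 1 -> `|b| = 1 ->
  rdot (a *: X q + b *: adjoint Y q) p <=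
    numradius (block_op \0 X Y \0) * (rnorm p ^+ 2 + rnorm q ^+ 2).
Proof.
move=> a1 b1; pose k := sqrtC (a * b).
have k2 : k ^+ 2 = a * b by exact: sqrtCK.
have k1 : `|k| = 1.
  by apply/eqP; rewrite -(@eqrXn2 _ 2)// expr1n -normrX k2 normrM a1 b1 mulr1.
pose z : hsum H H := (p, k *: q).
have zn : rnorm z ^+ 2 = rnorm p ^+ 2 + rnorm q ^+ 2.
  have -> : rnorm z ^+ 2 = complex.Re (inner z.1 z.1 + inner z.2 z.2).
    by rewrite -rdotxx.
  by rewrite ReD /= !rdotxx rnormZ_unimodular.
have := ler_numradius (block_op \0 X Y \0) z; rewrite zn; apply: le_trans.
have -> : inner (block_op \0 X Y \0 z) z = k * inner (X q) p + k^* * inner (Y p) q.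
  rewrite [LHS]/(hsum_inner _ _) /hsum_inner/block_op/= add0r addr0.
  by rewrite linearZ (linearZl_LR inner) (linearZr_LR inner).
have kk : k^* * k = 1 by exact: unimodularK.
have aa : a^* * a = 1 by exact: unimodularK.
rewrite (_ : rnorm _ = rnorm ((a * k^*) * (k * inner (X q) p + k^* * inner (Y p) q))); last first.
  by rewrite normrM normrM norm_conjC a1 k1 !mul1r.
apply: le_trans (ler_Re_norm _).
rewrite mulrDr ReD rdotDl !(linearZl_LR inner)/=.
have -> : (a * k^*) * (k * inner (X q) p) = a * inner (X q) p.
  by rewrite mulrA -(mulrA a) kk mulr1.
have -> : (a * k^*) * (k^* * inner (Y p) q) = b^* * inner (Y p) q.
  rewrite mulrA; congr (_ * _).
  rewrite -mulrA -expr2 -rmorphXn/= k2 rmorphM/= mulrA.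
  by rewrite (mulrC a) aa mul1r.
have -> : b^* * inner (Y p) q = (b * inner (adjoint Y q) p)^*.
  by rewrite rmorphM adjointP (inner_conj p).
by rewrite complexRe_conj.
Qed.

(** Apply the preceding bound to [p] parallel to [(a X + b Y^* ) q] and of norm
    [|q|], the choice for which [|p|^2 + |q|^2 = 2 |p| |q|]. *)
Lemma opnorm_combination_le X Y (a b : R[i]) : `|a| = 1 -> `|b| = 1 ->
  opnorm ((a \*: X) \+ (b \*: adjoint Y)) <= 2 * numradius (block_op \0 X Y \0).
Proof.
move=> a1 b1; set w := numradius _.
have w0 : 0 <= w by exact: numradius_ge0.
apply: opnorm_le => [|q]; first by rewrite mulr_ge0.
set v := _ q.
have [->|v0] := eqVneq v 0.
  by rewrite rnorm0 !mulr_ge0 ?rnorm_ge0.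
have nv := rnorm_gt0 v0; have nq := rnorm_ge0 q.
pose s := rnorm q / rnorm v; have s0 : 0 <= s by rewrite divr_ge0 ?rnorm_ge0.
have q0 : 0 < rnorm q.
  by apply: rnorm_gt0; apply: contra_neq v0 => q0; rewrite /v q0 linear0.
have := rdot_offdiag_le X Y (s%:C%C *: v) q a1 b1.
rewrite -/w -[_ *: _ + _]/v rdotZr rdotxx rnormZr// /s divfK ?gt_eqF//.
rewrite expr2 mulrA divfK ?gt_eqF// => h.
by rewrite -(ler_pM2l q0); nra.
Qed.

(** The common form of all the claimed inequalities; the right-hand side does not
    see the phase [c] because it bounds [l X + m Y^*] and its square uniformly in
    the unimodular scalars [l] and [m]. *)
Lemma numradius_pencil_le X Y (c : R[i]) : `|c| = 1 ->
  numradius (X \+ (c \*: Y)) <=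
    numradius (block_op \0 X Y \0) +
    2^-1 * Num.sqrt
      (opnorm (X \o X) + opnorm (adjoint Y \o adjoint Y) +
       opnorm ((X \o adjoint Y) \+ (adjoint Y \o X))).
Proof.
move=> c1; set w := numradius (block_op _ _ _ _); set D := (X in Num.sqrt X).
have w0 : 0 <= w by exact: numradius_ge0.
have D0 : 0 <= D by rewrite !addr_ge0 ?opnorm_ge0.
apply: sphere_sup_le => [|x x1]; first by rewrite addr_ge0 ?mulr_ge0 ?invr_ge0 ?sqrtr_ge0.
have [l l1 lE] := unimodular_rotate (inner ((X \+ (c \*: Y)) x) x).
pose m := (l * c)^*.
have lc1 : `|l * c| = 1 by rewrite normrM l1 c1 mulr1.
have m1 : `|m| = 1 by exact: unimodular_conj.
pose T := (l \*: X) \+ (m \*: adjoint Y).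
have -> : rnorm (inner ((X \+ (c \*: Y)) x) x) = rdot (T x) x.
  rewrite -lE /T/= !(linearDl inner)/= !(linearZl_LR inner)/= mulrDr !ReD.
  congr (_ + _); rewrite [RHS]/= mulrA -complexRe_conj rmorphM/= -/m; congr (complex.Re (_ * _)).
  by rewrite adjointP -inner_conj.
have TT : opnorm (T \o T) <= D.
  apply: opnorm_le => // y.
  have -> : (T \o T) y = (l ^+ 2) *: (X \o X) y + (m ^+ 2) *: (adjoint Y \o adjoint Y) y
      + (l * m) *: ((X \o adjoint Y) \+ (adjoint Y \o X)) y.
    rewrite /T/= !linearD/= !linearZ/= ?scalerDr !scalerA -!expr2 (mulrC m l).
    by rewrite [X in _ + X]addrC addrACA.
  rewrite /D !mulrDl.
  rewrite (le_trans (ler_rnormD _ _))// lerD//; last first.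
    rewrite rnormZ_unimodular; last by rewrite normrM l1 m1 mulr1.
    exact: ler_opnorm.
  rewrite (le_trans (ler_rnormD _ _))// lerD//.
    rewrite rnormZ_unimodular ?normrX ?l1 ?expr1n//; exact: ler_opnorm.
  rewrite rnormZ_unimodular ?normrX ?m1 ?expr1n//; exact: ler_opnorm.
apply: (le_trans (rdot_le_opnorm_sqr T x1)).
have := opnorm_combination_le X Y l1 m1; rewrite -/w -/T => nT.
have : Num.sqrt (opnorm (T \o T)) <= Num.sqrt D by rewrite ler_sqrt.
lra.
Qed.

End Block.

Theorem theorem2p1 (R : realType) (H : hilbertType R[i]) :
  (forall A B C D : {bounded H -> H},
    numradius ((A \o B) \+ (C \o D)) <=
      numradius (block_op \0 (A \o B) (C \o D) \0) +
      2^-1 * Num.sqrt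
        (opnorm ((A \o B) \o (A \o B)) +
         opnorm ((adjoint D \o adjoint C) \o (adjoint D \o adjoint C)) +
         opnorm (((A \o B) \o (adjoint D \o adjoint C)) \+
                 ((adjoint D \o adjoint C) \o (A \o B))))) /\
  (forall A C : {bounded H -> H},
    numradius (A \+ C) <=
      numradius (block_op \0 A C \0) +
      2^-1 * Num.sqrt
        (opnorm (A \o A) + opnorm (C \o C) +
         opnorm ((A \o adjoint C) \+ (adjoint C \o A))) /\
    numradius (A \- C) <=
      numradius (block_op \0 A C \0) +
      2^-1 * Num.sqrt
        (opnorm (A \o A) + opnorm (C \o C) +
         opnorm ((A \o adjoint C) \+ (adjoint C \o A)))).
Proof.
have sumE (X Y : {bounded H -> H}) : X \+ Y = X \+ (1 \*: Y).
  by apply/funext => x; rewrite /= scale1r.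
have subE (X Y : {bounded H -> H}) : X \- Y = X \+ (-1 \*: Y).
  by apply/funext => x; rewrite /= scaleN1r.
have pencil (A C : {bounded H -> H}) (c : R[i]) : `|c| = 1 ->
    numradius (A \+ (c \*: C)) <=
      numradius (block_op \0 A C \0) +
      2^-1 * Num.sqrt
        (opnorm (A \o A) + opnorm (C \o C) +
         opnorm ((A \o adjoint C) \+ (adjoint C \o A))).
  move=> c1; apply: (le_trans (numradius_pencil_le _ _ c1)).
  rewrite lerD2l ler_pM2l ?invr_gt0//; apply: ler_wsqrtr.
  by rewrite lerD2r lerD2l -adjoint_comp; exact: opnorm_adjoint_le.
split=> [A B C D|A C].
  rewrite sumE -adjoint_comp; apply: numradius_pencil_le; exact: normr1.
by split; [rewrite sumE|rewrite subE]; apply: pencil; rewrite ?normrN1 ?normr1.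
Qed.
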